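(* Let $N$ be a simple binary matroid of critical number $c \ge 1$ such that $\chi(N \setminus I) = c$ for every rank-$(r(N)-c+1)$ independent set $I$ of $N$. Then the critical threshold for $N$ is $1 - 2^{1-c}$.
   Context: Matroids are finite. For a matroid $M$, $E(M)$ is its ground set, $|M| = |E(M)|$, $r(M)$ is its rank, and $M \setminus I$ denotes deletion of $I$. A simple binary matroid of rank $r$ is viewed as a restriction of the projective geometry $G \cong \mathrm{PG}(r-1,2)$ (equivalently, as a set of nonzero vectors in $\mathrm{GF}(2)^r$). The critical number $\chi(M)$ is the minimum nonnegative integer $c$ such that $G$ has a rank-$(r-c)$ flat disjoint from $E(M)$; equivalently, the minimum codimension of a subspace of $\mathrm{GF}(2)^r$ containing no element of $E(M)$. For a simple binary matroid $N$, the critical threshold of $N$ is the infimum of all real $\alpha > 0$ such that there exists $c' = c'(N,\alpha)$ for which every simple binary matroid $M$ with no restriction isomorphic to $N$ and with $|M| \ge \alpha 2^{r(M)}$ satisfies $\chi(M) \le c'$. *)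

(* Defs.v *)
From mathcomp Require Import all_boot all_order all_algebra.
From mathcomp Require Import boolp classical_sets reals.

Set Implicit Arguments.
Unset Strict Implicit.
Unset Printing Implicit Defensive.

Import Order.TTheory GRing.Theory Num.Theory.

Local Open Scope ring_scope.

(* A simple binary matroid is a set of nonzero vectors over GF(2).  The ground
   set need not span the ambient space, so that all restrictions and deletions
   live in the same space; the rank-r(M) projective geometry containing M is
   the one given by the span of the ground set (see [mspan]). *)
Record simple_binary_matroid := SimpleBinaryMatroid {
  ambient_dim : nat;
  ground : {set 'rV['F_2]_ambient_dim};
  ground_nonzero : 0 \notin ground
}.

Notation point_of M := 'rV['F_2]_(ambient_dim M).

Definition mspan (M : simple_binary_matroid) : {vspace point_of M} :=
  <<enum (ground M)>>%VS.

Definition rank_set (M : simple_binary_matroid) (X : {set point_of M}) : nat :=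
  \dim <<enum X>>%VS.
Arguments rank_set : clear implicits.

Definition rank (M : simple_binary_matroid) : nat := rank_set M (ground M).

Definition indep (M : simple_binary_matroid) (X : {set point_of M}) : bool :=
  (X \subset ground M) && free (enum X).
Arguments indep : clear implicits.

Lemma restrict_nonzero (M : simple_binary_matroid) (X : {set point_of M}) :
  0 \notin ground M :&: X.
Proof. by rewrite inE negb_and ground_nonzero. Qed.

Definition restrict (M : simple_binary_matroid) (X : {set point_of M}) :=
  SimpleBinaryMatroid (restrict_nonzero X).
Arguments restrict : clear implicits.

Lemma delete_nonzero (M : simple_binary_matroid) (I : {set point_of M}) :
  0 \notin ground M :\: I.
Proof. by rewrite inE negb_and ground_nonzero orbT. Qed.

Definition delete (M : simple_binary_matroid) (I : {set point_of M}) :=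
  SimpleBinaryMatroid (delete_nonzero I).
Arguments delete : clear implicits.

(* Matroid isomorphism: a bijection between the ground sets that preserves
   independence in both directions.  Values of [f] off the ground set of [N]
   are irrelevant. *)
Definition isomorphic (N M : simple_binary_matroid) : Prop :=
  exists f : point_of N -> point_of M,
    [/\ {in ground N &, injective f},
        f @: ground N = ground M
      & forall X : {set point_of N}, X \subset ground N ->
          indep M (f @: X) = indep N X].

Definition has_restriction (M N : simple_binary_matroid) : Prop :=
  exists X : {set point_of M},
    X \subset ground M /\ isomorphic N (restrict M X).

(* The projective geometry of [mspan M] has a flat of rank r(M) - c disjoint
   from the ground set; flats are given by the corresponding subspaces. *)
Definition has_avoiding_flat (M : simple_binary_matroid) (c : nat) : Prop :=
  exists U : {vspace point_of M},
    [/\ (U <= mspan M)%VS, (\dim U + c)%N = rank M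
      & forall x, x \in ground M -> x \notin U].

Lemma avoiding_flat_rank (M : simple_binary_matroid) :
  has_avoiding_flat M (rank M).
Proof.
exists 0%VS; split; rewrite ?sub0v ?dimv0 //.
by move=> x xM; rewrite memv0; apply: contraNneq (ground_nonzero M) => <-.
Qed.

Lemma avoiding_flat_exists (M : simple_binary_matroid) :
  exists c, `[< has_avoiding_flat M c >].
Proof. by exists (rank M); apply/asboolP; apply: avoiding_flat_rank. Qed.

Definition critical_number (M : simple_binary_matroid) : nat :=
  ex_minn (avoiding_flat_exists M).

(* [inf] is the genuine infimum here: the set is bounded below by 0 and
   contains 1, since |M| < 2 ^ r(M) for every simple binary matroid M. *)
Definition critical_threshold (R : realType) (N : simple_binary_matroid) : R :=
  inf [set alpha : R | 0 < alpha /\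
    exists c' : nat, forall M : simple_binary_matroid,
      ~ has_restriction M N ->
      alpha * 2 ^+ rank M <= #|ground M|%:R ->
      (critical_number M <= c')%N]%classic.

(* Main.v *)
(* Upper bound: a geometric Erdos-Stone argument.  A set A of density above
   1 - 2^(1-c) + eps in GF(2)^n contains W \ U for nested subspaces U < W with
   codim_W U = c and dim U as large as desired, hence a copy of N.  Inductively
   take W \ U in A with codim_W U = c - 1.  Averaging over the cosets y + W, one
   of them meets A in density above 1 - 2^(1-c), so a positive proportion of the
   u in U have all 2^(c-1) translates of y + u by representatives of W / U in A;
   an affine cube u0 + U' in this set of u gives the next pair.  So matroids
   without N-restriction that are this dense have bounded rank.

   Lower bound: with d = c - 1, let M be the complement of a codimension-d
   subspace U, together with a set L in U without short circuits and of large
   critical number.  If N embeds in M, then I = N meet L is independent.  If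
   |I| <= r(N) - d, extend I to an independent set of rank r(N) - c + 1; deleting
   it leaves critical number at most d, contrary to the hypothesis.  Otherwise
   span(N) meets U in codimension less than d, and one more functional, equal to
   1 on I, shows that N itself has critical number at most d. *)
Require Import Defs.
From mathcomp Require Import all_boot all_order all_algebra.
From mathcomp Require Import boolp classical_sets reals.
From mathcomp Require Import zify lra.

Set Implicit Arguments.
Unset Strict Implicit.
Unset Printing Implicit Defensive.

Import Order.TTheory GRing.Theory Num.Theory.

Local Open Scope ring_scope.

(** * Affine cubes in dense sets *)

Lemma F2_cases (b : 'F_2) : b = 0 \/ b = 1.
Proof. by case: b => [[|[|]]] // i; [left | right]; apply: val_inj. Qed.

Lemma addrr_F2 m n (A : 'M['F_2]_(m, n)) : A + A = 0.
Proof.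
by apply/matrixP => i j; rewrite !mxE; case: (F2_cases (A i j)) => ->; apply: val_inj.
Qed.

Lemma oppmx_F2 m n (A : 'M['F_2]_(m, n)) : - A = A.
Proof. by apply/esym/eqP; rewrite -addr_eq0 addrr_F2. Qed.

Lemma card_rV_F2 n : #|{: 'rV['F_2]_n}| = (2 ^ n)%N.
Proof. by rewrite card_mx card_Fp // mul1n. Qed.

Lemma card_submx_le j m (D : 'M['F_2]_(j, m)) :
  (#|[set d : 'rV_m | (d <= D)%MS]| <= 2 ^ j)%N.
Proof.
rewrite -(card_rV_F2 j) -cardsT.
apply: leq_trans _ (leq_imset_card (fun z : 'rV_j => z *m D) _).
by apply/subset_leq_card; apply/fintype.subsetP => d; rewrite inE => /submxP[z ->]; apply: imset_f.
Qed.

Lemma sum_le_card_max (T : finType) (P : pred T) (F : T -> nat) (x0 : T) :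
  P x0 -> exists2 x, P x & (\sum_(y | P y) F y <= #|P| * F x)%N.
Proof.
move=> Px0; case: (arg_maxnP F Px0) => x Px maxx; exists x => //.
rewrite -sum_nat_const; exact: leq_sum.
Qed.

Lemma sum_ge_card_min (T : finType) (P : pred T) (F : T -> nat) (x0 : T) :
  P x0 -> exists2 x, P x & (#|P| * F x <= \sum_(y | P y) F y)%N.
Proof.
move=> Px0; case: (arg_minnP F Px0) => x Px minx; exists x => //.
rewrite -sum_nat_const; exact: leq_sum.
Qed.

Lemma mul_rV_col a b m (z : 'rV['F_2]_(a + b)) (A : 'M_(a, m)) (B : 'M_(b, m)) :
  z *m col_mx A B = lsubmx z *m A + rsubmx z *m B.
Proof. by rewrite -{1}(hsubmxK z) mul_row_col. Qed.

Lemma submx_addKr j m (D : 'M['F_2]_(j, m)) (x y : 'rV_m) :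
  ((x + y)%R <= D)%MS -> (y <= D)%MS -> (x <= D)%MS.
Proof.
by move=> xyD yD; have := addmx_sub xyD yD; rewrite -addrA addrr_F2 addr0.
Qed.

(** Double counting of the pairs [b], [b + d] in [B]: each [b] has [#|B|] differences, at most
    [2 ^ j] of them in [D], which is at most half. The best [d] serves at least [#|B|^2 / 2^(m+1)]
    points. *)
Lemma popular_difference e j m (B : {set 'rV['F_2]_m}) (D : 'M['F_2]_(j, m)) :
  (e + j + 1 <= m)%N -> (2 ^ m <= #|B| * 2 ^ e)%N ->
  exists2 d : 'rV_m, ~~ (d <= D)%MS &
    (2 ^ m <= #|[set b in B | (b + d)%R \in B]| * 2 ^ (2 * e + 1))%N.
Proof.
move=> lem densB.
have card_shift b : b \in B ->
    (#|B| <= #|[set d | ~~ (d <= D)%MS && ((b + d)%R \in B)]| + 2 ^ j)%N.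
  move=> bB; rewrite -(card_imset B (addrI b)) addnC.
  apply: leq_trans _ (leq_add (card_submx_le D) (leqnn _)).
  apply: leq_trans _ (leq_of_leqif (leq_card_setU _ _)).
  apply/subset_leq_card; apply/fintype.subsetP => d.
  case/imsetP => x xB ->; rewrite !inE addrA addrr_F2 add0r xB andbT.
  exact: orbN.
have two_j : (2 ^ j * 2 <= #|B|)%N.
  rewrite -(leq_pmul2r (expn_gt0 2 e)) -expnSr -expnD; apply: leq_trans _ densB.
  by rewrite leq_exp2l //; lia.
have [d0 nd0] : exists d : 'rV_m, ~~ (d <= D)%MS.
  apply/existsP; rewrite -negb_forall; apply/negP => /forallP allD.
  have := card_submx_le D.
  rewrite (_ : [set _ | _] = finset.setT); last by apply/setP => d; rewrite !inE allD.
  by rewrite cardsT card_rV_F2 leqNgt ltn_exp2l //; lia.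
have [d nd] := @sum_le_card_max _ (fun d : 'rV_m => ~~ (d <= D)%MS)
  (fun d => #|[set b in B | (b + d)%R \in B]|) d0 nd0.
have -> : (\sum_(d | ~~ (d <= D)%MS) #|[set b in B | (b + d)%R \in B]| =
   \sum_(b in B) #|[set d | ~~ (d <= D)%MS && ((b + d)%R \in B)]|)%N.
  under eq_bigr do rewrite -sum1_card.
  rewrite (exchange_big_dep (mem B)) /=; last by move=> i b _; rewrite inE => /andP[].
  apply: eq_bigr => b bB; rewrite -sum1_card; apply: eq_bigl => i.
  by rewrite !inE bB.
set F := #|[set _ in B | _]| => sumle; exists d => //; rewrite -/F.
have cardP : (#|[pred d : 'rV['F_2]_m | ~~ (d <= D)%MS]| <= 2 ^ m)%N.
  by rewrite -card_rV_F2 max_card.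
have {sumle} : (#|B| * #|B| <= 2 ^ m * F * 2)%N.
  have H1 : (#|B| * (#|B| - 2 ^ j) <= 2 ^ m * F)%N.
    apply: leq_trans _ (leq_mul cardP (leqnn F)); apply: leq_trans _ sumle.
    rewrite -sum_nat_const; apply: leq_sum => b bB.
    by rewrite leq_subLR addnC card_shift.
  have H2 : (#|B| * #|B| <= #|B| * (#|B| - 2 ^ j) * 2)%N.
    by rewrite -mulnA leq_mul2l; apply/orP; right; lia.
  by apply: leq_trans H2 _; rewrite leq_mul2r H1 orbT.
move=> BB; rewrite -(leq_pmul2l (expn_gt0 2 m)).
apply: leq_trans (leq_mul densB densB) _.
rewrite mulnACA -expnD addnn -mul2n expnD expn1.
by rewrite (mulnC _ 2) [X in (_ <= X)%N]mulnA mulnA leq_mul2r BB orbT.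
Qed.

(* Avoiding [D] guarantees that the directions found so far stay independent
   of the new ones. *)
Lemma affine_cube k e j : exists m0, forall m (B : {set 'rV['F_2]_m})
    (D : 'M['F_2]_(j, m)), (m0 <= m)%N -> (2 ^ m <= #|B| * 2 ^ e)%N ->
  exists (u : 'rV_m) (Psi : 'M_(k, m)),
    (forall z : 'rV_k, (z *m Psi <= D)%MS -> z = 0) /\
    (forall z : 'rV_k, u + z *m Psi \in B).
Proof.
elim: k e j => [|k IHk] e j.
  exists 0%N => m B D _ densB.
  have [u uB] : exists u, u \in B.
    apply/set0Pn; rewrite -card_gt0.
    by case: #|B| densB => //; rewrite mul0n leqn0 expn_eq0.
  exists u, 0; split=> z; first by rewrite (thinmx0 z).
  by rewrite mulmx0 addr0.
have [m0 cube] := IHk (2 * e + 1)%N (j + 1)%N.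
exists (maxn m0 (e + j + 1)) => m B D; rewrite geq_max => /andP[m0m ejm] densB.
have [d nd densBd] := popular_difference D ejm densB.
(* A cube in the set of [b] with both [b] and [b + d] in [B] doubles along [d]. *)
have [u [Psi [Psi_inj PsiB]]] := cube m _ (col_mx D d) m0m densBd.
exists u, (col_mx d Psi : 'M_(1 + k, m)); split=> z; rewrite (@mul_rV_col 1).
  set b := lsubmx _; set z' := rsubmx _ => bzD.
  have z'0 : z' = 0.
    apply: Psi_inj; apply: (@submx_addKr _ _ _ _ (b *m d)).
      rewrite addrC; apply: submx_trans bzD _.
      by rewrite -addsmxE addsmxSl.
    by rewrite -addsmxE (submx_trans (submxMl _ _)) ?addsmxSr.
  move: bzD; rewrite z'0 mul0mx addr0 -[z](@hsubmxK _ _ 1) -/b -/z' z'0.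
  rewrite [b]mx11_scalar.
  case: (F2_cases (b 0 0)) => ->; first by rewrite raddf0 row_mx0.
  by rewrite mul1mx (negPf nd).
have := PsiB (rsubmx (z : 'rV_(1 + k))); rewrite inE => /andP[].
set b := lsubmx _; rewrite [b]mx11_scalar.
case: (F2_cases (b 0 0)) => -> uB udB; first by rewrite raddf0 mul0mx add0r.
by rewrite mul1mx addrCA addrC.
Qed.

(** * The geometric Erdos-Stone theorem *)

(** Averaging over cosets, with [E = 2^e], [K = 2^k'], [C = 2^c], [D] the number of vectors outside
    W, [a = #|~: A|], and [b] the least number of points of a coset that miss [A]. Leaving W out of
    the average costs half of the surplus: [1/(2E)] becomes [1/(4E)]. *)
Lemma average_arith (b a E D K C : nat) :
  (D * b <= K * C * a)%N -> (a * (2 * C * E) + (D + K * C) <= 2 * E * (D + K * C))%N ->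
  (4 * E * (K * C) <= D + K * C)%N -> (0 < E)%N -> (0 < C)%N -> (0 < K)%N ->
  (b * (4 * E) + K <= K * (4 * E))%N.
Proof.
move=> bad dens big E0 C0 K0; rewrite leqNgt; apply/negP => lt.
have E1 : exists E', E = E'.+1 by exists E.-1; rewrite prednK.
case: E1 => E' ?; subst E; set M := (K * C)%N in bad dens big.
have M0 : (0 < M)%N by rewrite muln_gt0 K0.
have H1 : (D * b * (2 * E'.+1) <= K * ((2 * E' + 1) * (D + M)))%N.
  apply: (@leq_trans (K * (a * (2 * C * E'.+1)))); last by rewrite leq_mul2l; lia.
  have -> : (K * (a * (2 * C * E'.+1)) = M * a * (2 * E'.+1))%N by rewrite /M; lia.
  by rewrite leq_mul2r bad orbT.
have H2 : (D * (K * (4 * E' + 3)) <= D * (b * (4 * E'.+1)))%N by rewrite leq_mul2l; lia.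
have H3 : ((4 * E' + 3) * M <= D)%N by lia.
have H4 : (D * K <= K * ((4 * E' + 2) * M))%N by lia.
have H5 : (D <= (4 * E' + 2) * M)%N by rewrite -(leq_pmul2l K0) mulnC.
lia.
Qed.

(* In the notation of the header, W and U are the images under [Phi] of all
   vectors and of those with [v = 0]. *)
Lemma bose_burton_blowup k c e : exists n0, forall n (A : {set 'rV['F_2]_n}),
  (n0 <= n)%N -> (#|~: A| * 2 ^ (c + e) + 2 ^ n <= 2 ^ (e + 1) * 2 ^ n)%N ->
  exists Phi : 'M['F_2]_(k + c, n),
    (forall x : 'rV_(k + c), x *m Phi = 0 -> x = 0) /\
    (forall (u : 'rV_k) (v : 'rV_c), v != 0 -> row_mx u v *m Phi \in A).
Proof.
elim: c k => [|c IHc] k.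
  (* For [c = 0] no [v] is nonzero, so any injective [Phi] works. *)
  exists k => n A kn _; exists (pid_mx (k + 0)); split=> [x /eqP|u v].
    by rewrite mulmx_free_eq0 /row_free ?rank_pid_mx // ?addn0 // => /eqP.
  by rewrite (thinmx0 v) eqxx.
(* The smaller codimension is solved with [k'] so large that every subset of density [2^-(e+2)] in
   dimension [k'] contains a [k]-dimensional cube. *)
have [k' cube] := affine_cube k (e + 2) 0; have [n1 IH] := IHc k'.
exists (maxn n1 (k' + c + e + 2)) => n A; rewrite geq_max => /andP[n1n len] densA.
have [|Phi [Phi_inj PhiA]] := IH n A n1n.
  apply: leq_trans densA; rewrite leq_add2r leq_mul2l leq_exp2l //.
  by rewrite addSn leqnSn orbT.
pose bad (y : 'rV['F_2]_n) := [set w | y + w *m Phi \notin A].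
have card_out : (2 ^ n - 2 ^ (k' + c) <= #|[pred y : 'rV['F_2]_n | ~~ (y <= Phi)%MS]|)%N.
  rewrite leq_subLR -(card_rV_F2 n) -(cardsC [set y : 'rV_n | (y <= Phi)%MS]).
  apply: leq_add (card_submx_le _) _.
  by apply: eq_leq; apply: eq_card => y; rewrite !inE.
have lt_pow : (2 ^ (k' + c) < 2 ^ n)%N by rewrite ltn_exp2l //; lia.
have [y0 ny0] : exists y, y \in [pred y : 'rV['F_2]_n | ~~ (y <= Phi)%MS].
  apply/card_gt0P; apply: leq_trans card_out; by rewrite subn_gt0.
have [y ny] := @sum_ge_card_min _ (fun y : 'rV_n => ~~ (y <= Phi)%MS) (fun y => #|bad y|) y0 ny0.
move=> /(leq_trans (leq_mul card_out (leqnn _))) min_bad.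
(* For fixed [w], at most [#|~: A|] vectors [y] put [y + w *m Phi] outside [A]. *)
have {min_bad} bad_le : ((2 ^ n - 2 ^ (k' + c)) * #|bad y| <= 2 ^ (k' + c) * #|~: A|)%N.
  apply: leq_trans min_bad _.
  apply: (@leq_trans (\sum_(y : 'rV['F_2]_n) #|bad y|)).
    by rewrite [X in (_ <= X)%N](bigID (fun y : 'rV_n => ~~ (y <= Phi)%MS)) leq_addr.
  under eq_bigr do rewrite -sum1_card.
  rewrite (exchange_big_dep predT) //= -card_rV_F2 -sum_nat_const.
  apply: leq_sum => w _; rewrite sum1_card -(card_imset _ (addIr (w *m Phi))).
  apply/subset_leq_card; apply/fintype.subsetP => _ /imsetP[x xw ->].
  by have {}xw : w \in bad x by []; move: xw; rewrite !inE.
pose B := [set u : 'rV['F_2]_k' | [forall v : 'rV_c, y + row_mx u v *m Phi \in A]].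
(* Every [u] outside [B] is the first block of a bad vector. *)
have cardCB : (#|~: B| <= #|bad y|)%N.
  apply: leq_trans (leq_imset_card (fun w : 'rV_(k' + c) => lsubmx w) _).
  apply/subset_leq_card; apply/fintype.subsetP => u; rewrite !inE => /forallPn[v nA].
  by apply/imsetP; exists (row_mx u v); rewrite ?row_mxKl // inE.
have densB : (2 ^ k' <= #|B| * 2 ^ (e + 2))%N.
  have E4 : (4 * 2 ^ e = 2 ^ (e + 2))%N by rewrite expnD mulnC.
  have D2 : (2 ^ n - 2 ^ (k' + c) + 2 ^ k' * 2 ^ c = 2 ^ n)%N.
    by rewrite -expnD subnK // ltnW.
  have := @average_arith #|bad y| #|~: A| (2 ^ e) (2 ^ n - 2 ^ (k' + c)) (2 ^ k') (2 ^ c).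
  rewrite D2 -(expnD 2 k' c) => /(_ bad_le).
  rewrite (_ : 2 * 2 ^ c * 2 ^ e = 2 ^ (c.+1 + e))%N; last by rewrite expnD expnS.
  rewrite (_ : 2 * 2 ^ e = 2 ^ (e + 1))%N; last by rewrite addn1 expnS.
  rewrite E4 !expn_gt0 /= => /(_ densA) H.
  have /H : (2 ^ (e + 2) * 2 ^ (k' + c) <= 2 ^ n)%N by rewrite -expnD leq_exp2l //; lia.
  move=> /(_ isT isT isT).
  have CBq : (#|~: B| * 2 ^ (e + 2) <= #|bad y| * 2 ^ (e + 2))%N by rewrite leq_mul2r cardCB orbT.
  move=> Hq; have {}Hq := leq_trans (leq_add CBq (leqnn _)) Hq.
  have cB : (#|B| + #|~: B| = 2 ^ k')%N by rewrite cardsC card_rV_F2.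
  by move: Hq; rewrite -cB mulnDl addnC leq_add2r.
have [u0 [Psi [Psi_inj PsiB]]] := cube k' B (0 : 'M_(0, k')) (leqnn _) densB.
(* The first coordinate of [v] chooses between W (value 0, handled by [PhiA]) and the coset of [y]
   (value 1, handled by the cube in [B]). The cube directions span the new U. *)
exists (col_mx (Psi *m usubmx Phi)
         (col_mx (y + u0 *m usubmx Phi) (dsubmx Phi) : 'M_(1 + c, n))).
have rowE (a : 'rV['F_2]_k') (v : 'rV_c) :
    row_mx a v *m Phi = a *m usubmx Phi + v *m dsubmx Phi.
  by rewrite -{1}(vsubmxK Phi) mul_row_col.
split=> [x|u v nv].
  rewrite -[x](@hsubmxK _ _ k c.+1) mul_row_col (@mul_rV_col 1).
  set z := lsubmx x; set b := lsubmx _; set v := rsubmx _.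
  rewrite [b]mx11_scalar; case: (F2_cases (b 0 0)) => b0; rewrite b0 => x0.
    have /Phi_inj : row_mx (z *m Psi) v *m Phi = 0.
      by rewrite rowE -x0 raddf0 mul0mx add0r mulmxA.
    rewrite -(row_mx0 _ 1 k' c) => /eq_row_mx[zPsi v0].
    have -> : z = 0 by apply: Psi_inj; rewrite zPsi sub0mx.
    have -> : rsubmx x = 0.
      by rewrite -[rsubmx x](@hsubmxK _ _ 1) -/v v0 -/b [b]mx11_scalar b0 raddf0 row_mx0.
    by rewrite row_mx0.
  (* With new coordinate 1, a vanishing combination would put [y] in W. *)
  case/negP: ny; apply/submxP; exists (row_mx (z *m Psi + u0) v).
  rewrite rowE mulmxDl -mulmxA; apply/eqP; rewrite -subr_eq0 -x0 mul1mx.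
  apply/eqP/esym.
  by rewrite oppmx_F2 -!addrA [LHS]addrCA.
rewrite mul_row_col (@mul_rV_col 1).
set b := lsubmx _; set w := rsubmx _; rewrite [b]mx11_scalar.
have yA z' : y + row_mx (u0 + u *m Psi) z' *m Phi \in A.
  by move: (PsiB u); rewrite inE => /forallP.
case: (F2_cases (b 0 0)) => b0; rewrite b0.
  have w0 : w != 0.
    apply: contraNneq nv => w0; rewrite -[v](@hsubmxK _ _ 1) -/b -/w w0.
    by rewrite [b]mx11_scalar b0 raddf0 row_mx0.
  by have := PhiA (u *m Psi) w w0; rewrite rowE raddf0 mul0mx add0r mulmxA.
have := yA w; rewrite rowE mul1mx mulmxDl mulmxA.
by rewrite -!addrA (addrCA (u0 *m _)) (addrCA y).
Qed.

(** * Sparse sets of large critical number *)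

Lemma card_ker_ge n k (P : 'M['F_2]_(n, k)) :
  (2 ^ n <= 2 ^ k * #|[set x : 'rV_n | x *m P == 0%R]|)%N.
Proof.
pose K := row_base (kermx P).
have K_inj : injective (fun x : 'rV_(\rank (kermx P)) => x *m K).
  exact/row_free_inj/row_base_free.
apply: (@leq_trans (2 ^ k * 2 ^ \rank (kermx P))).
  rewrite -expnD leq_exp2l // mxrank_ker; have := rank_leq_col P; lia.
rewrite leq_mul2l; apply/orP; right; rewrite -card_rV_F2 -(card_imset _ K_inj).
apply/subset_leq_card; apply/fintype.subsetP => _ /imsetP[x _ ->]; rewrite inE.
have /submxP[D ->] : (x *m K <= kermx P)%MS.
  by apply: submx_trans (submxMl _ _) _; rewrite eq_row_base.
by rewrite -mulmxA mulmx_ker mulmx0.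
Qed.

(** Over GF(2) circuits are the minimal nonempty sets with sum 0, so this is girth greater than
    [g]. *)
Definition short_circuit_free g n (L : {set 'rV['F_2]_n}) :=
  forall S : {set 'rV_n}, S \subset L -> (#|S| <= g)%N ->
    \sum_(x in S) x = 0 -> S = finset.set0.

(** The summand 0 pads shorter sums to [g] terms. Repeated summands are harmless: the set only has
    to be small and contain all sums of at most [g] distinct points. *)
Definition short_sums g n (L : {set 'rV['F_2]_n}) : {set 'rV_n} :=
  [set \sum_(i < g) s i | s : {ffun 'I_g -> 'rV_n} in ffun_on (mem (0 |: L))].

Lemma card_short_sums g n (L : {set 'rV['F_2]_n}) :
  (#|short_sums g L| <= #|L|.+1 ^ g)%N.
Proof.
apply: leq_trans (leq_imset_card _ _) _.
rewrite card_ffun_on card_ord; case: g => // g.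
by rewrite leq_exp2r // cardsU1; case: (_ \notin _).
Qed.

Lemma mem_short_sums g n (L S : {set 'rV['F_2]_n}) :
  S \subset L -> (#|S| <= g)%N -> \sum_(x in S) x \in short_sums g L.
Proof.
move=> SL Sg; apply/imsetP; exists [ffun i : 'I_g => (enum S)`_i].
  apply/ffun_onP => i; rewrite ffunE inE.
  have [iS|Si] := ltnP i (size (enum S)); last by rewrite nth_default ?set11.
  rewrite [X in _ || X](fintype.subsetP SL) ?orbT //.
  by rewrite -mem_enum mem_nth.
rewrite [RHS](eq_bigr (fun i : 'I_g => (enum S)`_i)); last by move=> i _; rewrite ffunE.
rewrite -big_enum (big_nth 0) big_mkord -cardE.
rewrite (big_ord_widen g (fun i => (enum S)`_i) Sg) [RHS](bigID (fun i : 'I_g => (i < #|S|)%N)) /=.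
rewrite [X in _ = _ + X]big1 ?addr0 //.
by move=> i; rewrite -leqNgt cardE => ?; rewrite nth_default.
Qed.

Lemma short_circuit_free_extend g n (L : {set 'rV['F_2]_n}) x :
  short_circuit_free g L -> x \notin short_sums g L ->
  short_circuit_free g (x |: L).
Proof.
move=> Lfree xL S; rewrite -subDset => SL Sg S0.
have [xS|xS] := boolP (x \in S); last first.
  apply: Lfree => //; apply: fintype.subset_trans SL.
  by rewrite subsetD1 fintype.subxx.
case/negP: xL; have -> : x = \sum_(y in S :\ x) y.
  apply/eqP; rewrite -subr_eq0 oppmx_F2; move: S0.
  by rewrite (big_setD1 x) //= => ->.
apply: mem_short_sums => //; apply: leq_trans Sg.
exact/subset_leq_card/subD1set.
Qed.

(** Count the pairs with [x *m P = 0]: each kernel has at least [2^(n-k)] points, at most half of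
    them in [F], and the best [x] outside [F] reaches the average. *)
Lemma popular_zero n k (Q : {set 'M['F_2]_(n, k)}) (F : {set 'rV['F_2]_n}) :
  (2 ^ (k + 1) * #|F| <= 2 ^ n)%N ->
  exists2 x, x \notin F & (#|Q| <= 2 ^ (k + 1) * #|[set P in Q | x *m P == 0%R]|)%N.
Proof.
move=> smallF.
have [x0 nx0] : exists x, x \notin F.
  apply/existsP; rewrite -negb_forall; apply/negP => /forallP allF.
  have FT : #|F| = (2 ^ n)%N by rewrite -(card_rV_F2 n); apply: eq_card => x; rewrite allF.
  move: smallF; rewrite FT.
  by rewrite -expnD leq_exp2l // leqNgt; lia.
have [x xF maxx] := @sum_le_card_max _ (fun x => x \notin F)
  (fun x => #|[set P in Q | x *m P == 0%R]|) x0 nx0.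
exists x => //; rewrite -(leq_pmul2l (expn_gt0 2 n)).
have {}maxx : (\sum_(y | y \notin F) #|[set P in Q | y *m P == 0%R]| <=
   2 ^ n * #|[set P in Q | x *m P == 0%R]|)%N.
  apply: leq_trans maxx _; rewrite leq_mul2r -card_rV_F2 max_card orbT //.
rewrite mulnCA; apply: (@leq_trans _ _ _ _ (leq_mul (leqnn (2 ^ (k + 1))) maxx)).
under eq_bigr do rewrite -sum1_card.
rewrite (exchange_big_dep (mem Q)) /=; last by move=> i P _; rewrite inE => /andP[].
rewrite big_distrr mulnC -sum_nat_const; apply: leq_sum => P PQ /=.
pose Z := [set x : 'rV['F_2]_n | x *m P == 0%R].
rewrite (_ : \sum_(i | _) 1 = #|Z :\: F|)%N; last first.
  by rewrite -sum1_card; apply: eq_bigl => i; rewrite !inE PQ.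
have kZ : (2 ^ n <= 2 ^ k * #|Z|)%N := card_ker_ge P.
have cZ : (#|Z :&: F| + #|Z :\: F| = #|Z|)%N := cardsID F Z.
have ZF : (2 ^ k * #|Z :&: F| <= 2 ^ k * #|F|)%N.
  by rewrite leq_mul2l subset_leq_card ?orbT // subsetIr.
move: smallF kZ ZF; rewrite addn1 expnS -cZ mulnDr -!mulnA.
by move: (2 ^ k * _)%N (2 ^ k * _)%N (2 ^ k * _)%N => *; lia.
Qed.

(* Greedy construction: each new point kills a positive proportion of the
   surviving maps [P], while avoiding the few sums of at most [g] old points. *)
Lemma greedy_sparse g k n m : (2 ^ (k + 1) * m.+1 ^ g <= 2 ^ n)%N ->
  exists L : {set 'rV['F_2]_n}, [/\ (#|L| <= m)%N, short_circuit_free g L &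
    (#|[set P : 'M['F_2]_(n, k) | [forall (x | x \in L), x *m P != 0%R]]|
       * (2 ^ (k + 1)) ^ m <= (2 ^ (k + 1)).-1 ^ m * 2 ^ (n * k))%N].
Proof.
elim: m => [|m IHm] small.
  exists finset.set0; split; rewrite ?cards0 //.
    by move=> S; rewrite finset.subset0 => /eqP.
  rewrite !expn0 muln1 mul1n.
  by apply: leq_trans (max_card _) _; rewrite card_mx card_Fp.
have [|L [Lm Lfree LQ]] := IHm.
  apply: leq_trans small; rewrite leq_mul2l; apply/orP; right.
  by case: (posnP g) => [-> //|g0]; rewrite leq_exp2r // leqnSn.
set Q := [set P | _] in LQ.
have [|x xL xQ] := @popular_zero n k Q (short_sums g L).
  apply: leq_trans small; rewrite leq_mul2l; apply/orP; right.
  apply: leq_trans (card_short_sums g L) _.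
  by case: (posnP g) => [-> //|g0]; rewrite leq_exp2r // ltnS leqW.
exists (x |: L); split; first by rewrite cardsU1; case: (_ \notin _) => //; lia.
  exact: short_circuit_free_extend.
set Q' := [set P | _].
have QD : (#|Q'| + #|[set P in Q | x *m P == 0%R]| <= #|Q|)%N.
  rewrite -(cardsID [set P | x *m P == 0%R] Q) addnC; apply: leq_add.
    by apply/subset_leq_card; apply/fintype.subsetP => P; rewrite !inE.
  apply/subset_leq_card; apply/fintype.subsetP => P; rewrite !inE => /forallP allP.
  have := allP x; rewrite setU11 /= => ->; apply/forallP => y.
  by apply/implyP => yL; have := allP y; rewrite !inE yL orbT.
have a0 : (0 < 2 ^ (k + 1))%N by rewrite expn_gt0.
move: (2 ^ (k + 1))%N a0 LQ xQ => a a0 LQ xQ.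
have aQ' : (a * #|Q'| <= a.-1 * #|Q|)%N.
  move: QD xQ; move: #|Q'| #|Q| #|_| => q' q r; case: a a0 {LQ} => // a _ QD xQ.
  have := leq_mul (leqnn a.+1) QD; rewrite mulnDr !mulSn /= in xQ *.
  by move: (a * q')%N (a * r)%N (a * q)%N xQ => *; lia.
rewrite !expnS mulnCA mulnA.
apply: leq_trans (leq_mul aQ' (leqnn (a ^ m))) _.
by rewrite -!mulnA leq_mul2l LQ orbT.
Qed.

(** Bernoulli's inequality. It shows that [a] greedy rounds at least halve the bound on the
    surviving maps. *)
Lemma double_pred_expn a : (0 < a)%N -> (2 * a.-1 ^ a <= a ^ a)%N.
Proof.
case: a => // a _ /=; rewrite -[X in (_ <= X ^ _)%N]addn1.
have bern p : (a ^ p + p * a ^ p.-1 <= (a + 1) ^ p)%N.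
  elim: p => // p IHp; rewrite [leqRHS]expnS.
  apply: leq_trans (leq_mul (leqnn (a + 1)) IHp).
  case: p {IHp} => [|p]; first by rewrite !expn0 expn1 /=; lia.
  by rewrite /= !expnS; set b := (a ^ p)%N; nia.
by apply: leq_trans (bern a.+1); rewrite /= expnS; lia.
Qed.

Lemma exp_beats_linear g b : exists s, (s * g + b <= 2 ^ s)%N.
Proof.
(* Here [2^s = 4^u >= (u+1)^2], while [s * g = 2 * u * g <= u^2] and [b <= u]. *)
exists (2 * (2 * g + b))%N; set u := (2 * g + b)%N.
have ltu := ltn_expl u (isT : (1 < 2)%N).
rewrite mulnC expnM (_ : 2 ^ 2 = 4)%N //.
apply: (@leq_trans (u.+1 * u.+1)); first by rewrite /u; nia.
by rewrite (_ : 4 = 2 * 2)%N // expnMn leq_mul.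
Qed.

(** A binary analogue of graphs of large girth and chromatic number: every subspace of codimension
    at most [k] is the kernel of some [P], hence meets [L]. *)
Lemma sparse_high_critical_number (g k : nat) : exists n (L : {set 'rV['F_2]_n}),
  short_circuit_free g L /\
  (forall P : 'M['F_2]_(n, k), exists2 x, x \in L & x *m P = 0).
Proof.
have [s bound] := exp_beats_linear g ((2 * k + 3) * g + (k + 1)).
(* The [m] rounds form [n * k + 1] batches of [a], each halving the bound [2^(n*k)], so no map
   survives. As [n = 2^s], [m + 1] is at most [2^(s + 2k + 3)], whose [g]-th power is small against
   [2^n]. *)
set a := (2 ^ (k + 1))%N; set n := (2 ^ s)%N in bound; pose m := (a * (n * k + 1))%N.
have a0 : (0 < a)%N by rewrite expn_gt0.
have n0 : (0 < n)%N by rewrite expn_gt0.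
have a1 : (0 < a.-1)%N by rewrite /a addn1 expnS; have := expn_gt0 2 k; lia.
have small : (a * m.+1 ^ g <= 2 ^ n)%N.
  apply: leq_trans (_ : _ <= 2 ^ (s * g + ((2 * k + 3) * g + (k + 1))))%N _; last first.
    by rewrite leq_exp2l.
  rewrite addnA -mulnDl [leqRHS]expnD [leqLHS]mulnC leq_mul2r; apply/orP; right.
  rewrite expnM; case: g {bound} => // g; rewrite leq_exp2r // expnD.
  have k2 : (k + 2 <= 2 ^ (k + 1))%N by rewrite addn2 addn1 ltn_expl.
  rewrite (_ : 2 * k + 3 = (k + 1) + (k + 1) + 1)%N; last by lia.
  rewrite (expnD 2 (k + 1 + (k + 1))) (expnD 2 (k + 1)) -/a -/n expn1.
  rewrite -/a in k2; rewrite /m.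
  have n1 : (n * k + 2 <= n * (k + 2))%N by rewrite mulnDr leq_add2l leq_pmull.
  have nk := leq_trans n1 (leq_mul (leqnn n) k2).
  have ank := leq_mul (leqnn a) nk.
  apply: (@leq_trans (a * (n * k + 2))); first by rewrite !mulnDr; lia.
  by apply: leq_trans ank _; rewrite mulnCA leq_mul2l leq_pmulr ?orbT.
have [L [_ Lfree LQ]] := greedy_sparse small.
exists n, L; split=> // P.
move: LQ; set Q := [set P | _] => LQ.
suff Q0 : Q = finset.set0.
  have : P \notin Q by rewrite Q0 inE.
  rewrite inE => /forallPn[x]; rewrite negb_imply negbK => /andP[xL /eqP xP].
  by exists x.
apply/eqP; rewrite -cards_eq0 -leqn0 -ltnS; rewrite ltnNge; apply/negP => Qpos.
have : (a.-1 ^ m * 2 ^ (n * k) * 2 <= a ^ m)%N.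
  rewrite /m (expnM a.-1) (expnM a) -mulnA -expnSr -(addn1 (n * k)) [leqLHS]mulnC -expnMn.
  by rewrite leq_exp2r ?addn1 // double_pred_expn.
have : (a ^ m <= a.-1 ^ m * 2 ^ (n * k))%N.
  by apply: leq_trans LQ; rewrite leq_pmull.
have : (0 < a.-1 ^ m * 2 ^ (n * k))%N by rewrite muln_gt0 !expn_gt0 a1.
set q := (_ * 2 ^ (n * k))%N; move: q => q; lia.
Qed.

(** * Binary representations *)

Lemma sum_nth_enum n (X : {set 'rV['F_2]_n}) (k : 'rV_n -> 'F_2) :
  \sum_(i < size (enum X)) k (enum X)`_i *: (enum X)`_i = \sum_(x in X) k x *: x.
Proof. by rewrite -[RHS]big_enum /= [RHS](big_nth 0) big_mkord. Qed.

(** A linear relation over GF(2) is the indicator function of a subset. *)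
Lemma free_zero_sumP n (X : {set 'rV['F_2]_n}) :
  reflect (forall S : {set 'rV_n}, S \subset X -> \sum_(x in S) x = 0 -> S = finset.set0)
    (free (enum X)).
Proof.
have freeE := @freeP _ 'rV['F_2]_n _ (in_tuple (enum X)).
apply: (iffP freeE) => [freeX S SX S0|freeX k k0 i].
  apply/setP => x; rewrite inE; apply/negP => xS.
  have xX : x \in enum X by rewrite mem_enum (fintype.subsetP SX).
  have /freeX/(_ (Ordinal (etrans (index_mem x _) xX))) :
      \sum_(i < size (enum X)) ((enum X)`_i \in S)%:R *: (in_tuple (enum X))`_i = 0 :> 'rV['F_2]_n.
    rewrite (sum_nth_enum X (fun y => (y \in S)%:R)) -[RHS]S0.
    rewrite (big_setID S) /= (finset.setIidPr SX) [X in _ + X]big1 ?addr0.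
      by apply: eq_bigr => y ->; rewrite scale1r.
    by move=> y; rewrite inE => /andP[/negPf -> _]; rewrite scale0r.
  by rewrite /= nth_index // xS.
pose c (x : 'rV['F_2]_n) := oapp k 0 (insub (index x (enum X))).
have ck (j : 'I_(size (enum X))) : c (enum X)`_j = k j.
  by rewrite /c index_uniq ?enum_uniq ?ltn_ord // valK.
have := freeX [set x in X | c x == 1]; case: (F2_cases (k i)) => // ki.
have cX : [set x in X | c x == 1] \subset X.
  by apply/fintype.subsetP => x; rewrite inE => /andP[].
move=> /(_ cX) H.
have /H/setP/(_ (enum X)`_i) : \sum_(x in [set x in X | c x == 1]) x = 0.
  transitivity (\sum_(x in X) c x *: x); last first.
    by rewrite -sum_nth_enum -[RHS]k0; apply: eq_bigr => j _; rewrite ck.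
  rewrite [RHS](bigID (fun x => c x == 1)) /= [X in _ = _ + X]big1 ?addr0.
    rewrite (eq_bigl (fun x => (x \in X) && (c x == 1))) => [|x]; last by rewrite inE.
    by apply: eq_bigr => x /andP[_ /eqP ->]; rewrite scale1r.
  by move=> x /andP[_]; case: (F2_cases (c x)) => ->; rewrite ?eqxx // scale0r.
by rewrite !inE ck ki eqxx andbT -mem_enum mem_nth.
Qed.

(** Relations among the points are zero-sum subsets, so the hypothesis puts the left kernel of the
    matrix [A] of points inside that of the matrix [H] of values. The rows of [A *m pinvmx A - 1]
    lie in the former, so [pinvmx A *m H] works. *)
Lemma zero_sum_linear n m (X : {set 'rV['F_2]_n}) (h : 'rV['F_2]_n -> 'rV['F_2]_m) :
  (forall S : {set 'rV_n}, S \subset X -> \sum_(x in S) x = 0 -> \sum_(x in S) h x = 0) ->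
  exists G : 'M_(n, m), forall x, x \in X -> x *m G = h x.
Proof.
move=> h0; pose A := \matrix_(i < #|X|) (enum_val i : 'rV['F_2]_n).
pose H := \matrix_(i < #|X|) h (enum_val i).
have rowsum p (f : 'rV['F_2]_n -> 'rV['F_2]_p) (u : 'rV_#|X|) :
    u *m (\matrix_(i < #|X|) f (enum_val i)) =
    \sum_(x in [set enum_val i | i : 'I_#|X| & u 0 i == 1]) f x.
  rewrite mulmx_sum_row big_imset /=; last by move=> i j _ _; apply: enum_val_inj.
  rewrite (bigID (fun i => u 0 i == 1)) /= [X in _ + X]big1 ?addr0.
    apply: eq_big => [i|i /eqP ->]; first by rewrite inE.
    by rewrite rowK scale1r.
  by move=> i; case: (F2_cases (u 0 i)) => ->; rewrite ?eqxx // scale0r.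
have kerAH (u : 'rV_#|X|) : u *m A = 0 -> u *m H = 0.
  move=> uA; apply: etrans (rowsum m h u) _; apply: h0; last first.
    by rewrite -[RHS]uA; apply/esym/(rowsum n id).
  by apply/fintype.subsetP => _ /imsetP[i _ ->]; apply: enum_valP.
exists (pinvmx A *m H).
have AH : A *m (pinvmx A *m H) = H.
  apply/eqP; rewrite -subr_eq0 mulmxA -{2}[H]mul1mx -mulmxBl; apply/eqP.
  apply/row_matrixP => i; rewrite row0 row_mul; apply: kerAH.
  by rewrite -row_mul mulmxBl mulmxKpV // mul1mx subrr row0.
move=> x xX; have := congr1 (row (enum_rank_in xX x)) AH.
by rewrite row_mul !rowK enum_rankK_in.
Qed.

(** [P] and [Q] model two zero-sum families with the same dependent sets. By induction on size: a
    nonempty [S] in one family contains a nonempty [S'] in the other; if [S'] is proper, then [S']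
    and [S :\: S'] are both smaller. *)
Lemma dependent_sets_agree (T : finType) (P Q : {set T} -> bool) (X : {set T}) :
  P finset.set0 -> Q finset.set0 ->
  (forall S S' : {set T}, S' \subset S -> P S' -> P S = P (S :\: S')) ->
  (forall S S' : {set T}, S' \subset S -> Q S' -> Q S = Q (S :\: S')) ->
  (forall S : {set T}, S \subset X ->
    (exists2 S' : {set T}, S' \subset S & (S' != finset.set0) && P S') <->
    (exists2 S' : {set T}, S' \subset S & (S' != finset.set0) && Q S')) ->
  forall S : {set T}, S \subset X -> P S = Q S.
Proof.
move=> P0 Q0 PD QD PQ S; have [n] := ubnP #|S|; elim: n S => // n IHn S Sn SX.
have IH (S' : {set T}) : S' \proper S -> P S' = Q S'.
  move=> S'S; apply: IHn; last exact: fintype.subset_trans (proper_sub S'S) SX.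
  by rewrite ltnS in Sn; apply: leq_trans Sn; apply: proper_card.
have properD (S' : {set T}) : S' \subset S -> S' != finset.set0 -> S :\: S' \proper S.
  move=> S'S S'0; rewrite properEcard finset.subsetDl /= cardsD (finset.setIidPr S'S).
  by rewrite ltn_subrL !card_gt0 S'0; apply: contraNneq S'0 => S0; rewrite S0 finset.subset0 in S'S.
have [->|S0] := eqVneq S finset.set0; first by rewrite P0 Q0.
apply/idP/idP => [PS|QS].
  have [] := (PQ S SX).1; first by exists S; rewrite ?S0.
  move=> S' S'S /andP[S'0 QS'].
  have [<- //|neS] := eqVneq S' S.
  have S'pS : S' \proper S by rewrite finset.properEneq neS.
  by rewrite (QD _ _ S'S QS') -IH ?properD // -PD // IH.
have [] := (PQ S SX).2; first by exists S; rewrite ?S0.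
move=> S' S'S /andP[S'0 PS'].
have [<- //|neS] := eqVneq S' S.
have S'pS : S' \proper S by rewrite finset.properEneq neS.
by rewrite (PD _ _ S'S PS') IH ?properD // -QD // -IH.
Qed.

Lemma sum_setD_F2 (T : finType) n (h : T -> 'rV['F_2]_n) (S S' : {set T}) :
  S' \subset S -> \sum_(x in S') h x == 0 ->
  (\sum_(x in S) h x == 0) = (\sum_(x in S :\: S') h x == 0).
Proof.
by move=> S'S /eqP S'0; rewrite (big_setID S') /= (finset.setIidPr S'S) S'0 add0r.
Qed.

(* Binary representations are unique: both zero-sum families are determined by
   their minimal members, the circuits. *)
Lemma independence_preserving_linear n m (X : {set 'rV['F_2]_n})
    (f : 'rV['F_2]_n -> 'rV['F_2]_m) :
  {in X &, injective f} ->
  (forall S : {set 'rV_n}, S \subset X -> free (enum (f @: S)) = free (enum S)) ->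
  exists G : 'M_(n, m), forall x, x \in X -> x *m G = f x.
Proof.
move=> f_inj f_free; apply: zero_sum_linear => S SX /eqP S0; apply/eqP; move: S0.
have sumf (S' : {set 'rV_n}) : S' \subset X -> \sum_(y in f @: S') y = \sum_(x in S') f x.
  by move=> S'X; rewrite big_imset //; apply: sub_in2 f_inj; apply/fintype.subsetP.
suff -> : (\sum_(x in S) x == 0) = (\sum_(x in S) f x == 0) by [].
apply: (@dependent_sets_agree _ (fun S => \sum_(x in S) x == 0)
  (fun S => \sum_(x in S) f x == 0) X) => //; rewrite ?big_set0 ?eqxx //.
- by move=> S1 S2; apply: (@sum_setD_F2 _ n (fun x => x)).
- by move=> S1 S2; apply: (@sum_setD_F2 _ m f).
move=> {SX} {}S SX.
have nfree p (Y : {set 'rV['F_2]_p}) : (exists2 S' : {set 'rV_p}, S' \subset Y &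
    (S' != finset.set0) && (\sum_(x in S') x == 0)) <-> ~~ free (enum Y).
  split=> [[S' S'Y /andP[S'0 /eqP sum0]]|].
    by apply: contra S'0 => /free_zero_sumP /(_ S' S'Y sum0) ->.
  move=> /free_zero_sumP/existsNP[S' /not_implyP[S'Y /not_implyP[/eqP sum0 /eqP S'0]]].
  by exists S'; rewrite ?S'0.
rewrite nfree -f_free // -nfree; split=> [[T TfS /andP[T0 sumT]]|[T TS /andP[T0 sumT]]].
  have fTS : [set x in S | f x \in T] \subset S.
    by apply/fintype.subsetP => x; rewrite inE => /andP[].
  exists [set x in S | f x \in T] => //.
  have fT : f @: [set x in S | f x \in T] = T.
    apply/setP => y; apply/imsetP/idP => [[x]|yT]; first by rewrite inE => /andP[_ ? ->].
    have /imsetP[x xS yE] := fintype.subsetP TfS _ yT.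
    by exists x; rewrite // inE xS -yE.
  rewrite -sumf ?fT ?sumT ?andbT; last exact: fintype.subset_trans SX.
  by apply: contraNneq T0 => E; rewrite -fT E imset0.
exists (f @: T); first exact: imsetS.
rewrite sumf ?sumT ?andbT; last exact: fintype.subset_trans SX.
by apply: contraNneq T0 => /eqP; rewrite imset_eq0.
Qed.

(** * Critical numbers *)

Lemma critical_number_le_rank M : (critical_number M <= rank M)%N.
Proof.
rewrite /critical_number; case: ex_minnP => c _; apply.
by apply/asboolP; apply: avoiding_flat_rank.
Qed.

(** Intersecting with [mspan M] does not increase codimension, so an avoiding subspace may be
    measured in any space containing [M]. *)
Lemma critical_number_le_subspace (M : simple_binary_matroid)
    (S X : {vspace point_of M}) k :
  (mspan M <= S)%VS -> (forall x, x \in ground M -> x \notin X) ->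
  (\dim S <= \dim (S :&: X) + k)%N -> (critical_number M <= k)%N.
Proof.
move=> MS avoidX dimS; pose U := (mspan M :&: X)%VS.
have UM : (\dim U <= rank M)%N by rewrite dimvS ?capvSl.
apply: (@leq_trans (rank M - \dim U)); last first.
  have := dimv_sum_cap (mspan M) (S :&: X).
  have : (\dim (mspan M + (S :&: X)) <= \dim S)%N.
    by rewrite dimvS // subv_add MS capvSl.
  have : (\dim (mspan M :&: (S :&: X)) <= \dim U)%N.
    by rewrite dimvS // capvA capvS // capvSl.
  rewrite (_ : \dim (mspan M) = rank M) //; lia.
rewrite /critical_number; case: ex_minnP => c _; apply; apply/asboolP.
exists U; split; rewrite ?capvSl // ?subnKC // => x xM.
by rewrite memv_cap negb_and avoidX ?orbT.
Qed.

Lemma dim_limg_le n k (P : 'M['F_2]_(n, k)) (V : {vspace 'rV['F_2]_n}) :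
  (\dim V <= \dim (V :&: lker (linfun (mulmxr P))) + k)%N.
Proof.
rewrite -(limg_ker_dim (linfun (mulmxr P)) V) leq_add2l.
by apply: leq_trans (dimvS (subvf _)) _; rewrite dimvf dim_matrix mul1r.
Qed.

Lemma mem_lker_mulmxr n k (P : 'M['F_2]_(n, k)) (x : 'rV_n) :
  (x \in lker (linfun (mulmxr P))) = (x *m P == 0).
Proof. by rewrite memv_ker lfunE. Qed.

Lemma critical_number_le_coloring (M : simple_binary_matroid) k
    (P : 'M['F_2]_(ambient_dim M, k)) :
  (forall x, x \in ground M -> x *m P != 0) -> (critical_number M <= k)%N.
Proof.
move=> P0; apply: (critical_number_le_subspace (subvv _) _ (dim_limg_le P _)).
by move=> x /P0; rewrite mem_lker_mulmxr.
Qed.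

(** The columns of [P] are the coordinates of the projection of [mspan M] along an optimal flat [U]
    onto a complement; inside the span they vanish together only on [U]. *)
Lemma critical_coloring (M : simple_binary_matroid) :
  exists P : 'M['F_2]_(ambient_dim M, critical_number M),
    forall x, x \in ground M -> x *m P != 0.
Proof.
rewrite /critical_number; case: ex_minnP => c /asboolP[U [UM dimU avoidU] _].
pose C := (mspan M :\: U)%VS.
have dimC : \dim C = c.
  have := dimv_cap_compl (mspan M) U; rewrite (capv_idPr UM) -/C.
  move: dimU; rewrite /rank /rank_set -/(mspan M) => <- /addnI //.
have UC0 : (C :&: U)%VS = 0%VS by exact: capv_diff.
case: _ / dimC; pose g (x : point_of M) := \row_i coord (vbasis C) i (daddv_pi C U x).
exists (\matrix_(i, j) g (delta_mx 0 i) 0 j) => x xM.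
have -> : x *m (\matrix_(i, j) g (delta_mx 0 i) 0 j) = g x.
  apply/rowP => j; rewrite !mxE [in RHS](row_sum_delta x) !linear_sum.
  by apply: eq_bigr => i _; rewrite !mxE !linearZ.
apply: contra (avoidU x xM) => /eqP/rowP gx.
have xS : x \in (C + U)%VS.
  by rewrite /C -{2}(capv_idPr UM) addv_diff_cap memv_span // mem_enum.
rewrite -(daddv_pi_add UC0 xS) (coord_vbasis (memv_pi C U x)) big1 ?add0r ?memv_pi //.
by move=> i _; have := gx i; rewrite !mxE => ->; rewrite scale0r.
Qed.

Lemma vspace_coordinates n (V : {vspace 'rV['F_2]_n}) :
  exists B : 'M['F_2]_(\dim V, n), (forall y : 'rV_(\dim V), y *m B = 0 -> y = 0) /\
    (forall x, x \in V -> exists y : 'rV_(\dim V), x = y *m B).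
Proof.
pose B := \matrix_(i < \dim V) (vbasis V)`_i; exists B.
have rowB (y : 'rV_(\dim V)) : y *m B = \sum_i y 0 i *: (vbasis V)`_i.
  by rewrite mulmx_sum_row; apply: eq_bigr => i _; rewrite rowK.
split=> [y|x xV].
  rewrite rowB => /(freeP (basis_free (vbasisP V))) y0.
  by apply/rowP => i; rewrite y0 mxE.
exists (\row_i coord (vbasis V) i x); rewrite rowB {1}(coord_vbasis xV).
by apply: eq_bigr => i _; rewrite mxE.
Qed.

(** * Dense matroids contain N *)

Lemma free_imset_injective n m (Phi : 'M['F_2]_(n, m)) (X : {set 'rV['F_2]_n}) :
  (forall x : 'rV_n, x *m Phi = 0 -> x = 0) ->
  free (enum [set x *m Phi | x in X]) = free (enum X).
Proof.
move=> Phi0; have Phi_inj : injective (fun x : 'rV_n => x *m Phi).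
  move=> x y /eqP; rewrite -subr_eq0 -mulmxBl => /eqP/Phi0/eqP.
  by rewrite subr_eq0 => /eqP.
have sumPhi (S : {set 'rV['F_2]_n}) :
    \sum_(y in [set x *m Phi | x in S]) y = (\sum_(x in S) x) *m Phi.
  by rewrite big_imset ?mulmx_suml //; apply: in2W.
apply/free_zero_sumP/free_zero_sumP => freeX S SX S0.
  apply/eqP; rewrite -(imset_eq0 (fun x : 'rV_n => x *m Phi)); apply/eqP.
  by apply: freeX; rewrite ?imsetS // sumPhi S0 mul0mx.
have SE : S = [set x *m Phi | x in [set x in X | x *m Phi \in S]].
  apply/setP => y; apply/idP/imsetP => [yS|[x]]; last by rewrite inE => /andP[_ ? ->].
  have /imsetP[x xX yE] := fintype.subsetP SX _ yS.
  by exists x; rewrite // inE xX -yE.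
move: S0; rewrite SE sumPhi => /Phi0 S0; rewrite (freeX _ _ S0) ?imset0 //.
by apply/fintype.subsetP => x; rewrite inE => /andP[].
Qed.

Lemma has_restriction_injective (M N : simple_binary_matroid)
    (Phi : 'M['F_2]_(ambient_dim N, ambient_dim M)) :
  (forall x : point_of N, x *m Phi = 0 -> x = 0) ->
  (forall x, x \in ground N -> x *m Phi \in ground M) -> has_restriction M N.
Proof.
move=> Phi0 PhiM; exists [set x *m Phi | x in ground N]; split.
  by apply/fintype.subsetP => _ /imsetP[x xN ->]; apply: PhiM.
exists (fun x => x *m Phi); split => [x y _ _ /eqP||X XN] /=.
- rewrite -subr_eq0 -mulmxBl => /eqP/Phi0/eqP.
  by rewrite subr_eq0 => /eqP.
- apply/esym/finset.setIidPr/fintype.subsetP => _ /imsetP[x xN ->]; exact: PhiM.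
rewrite /indep /= free_imset_injective // XN; congr (_ && _).
apply/fintype.subsetP => _ /imsetP[x xX ->].
have xN := fintype.subsetP XN _ xX.
by rewrite inE PhiM //=; apply/imsetP; exists x.
Qed.

(** Cleared of denominators, the hypothesis is density at least [1 - 2^(1-c) + 2^-(c+e)], with [c]
    the critical number of [N]. The map sending [x] to [(x, x *m P)] embeds [N] in W minus U,
    because the coloring [P] vanishes nowhere on [N]. *)
Lemma dense_has_restriction N e : exists n0, forall M : simple_binary_matroid,
  (n0 <= rank M)%N ->
  ((2 ^ rank M - #|ground M|) * 2 ^ (critical_number N + e) + 2 ^ rank M
     <= 2 ^ (e + 1) * 2 ^ rank M)%N ->
  has_restriction M N.
Proof.
have [P NP] := critical_coloring N.
have [n0 blowup] := bose_burton_blowup (ambient_dim N) (critical_number N) e.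
exists n0 => M n0M densM; have [B [B0 spanB]] := vspace_coordinates (mspan M).
pose A : {set 'rV['F_2]_(\dim (mspan M))} := [set y | y *m B \in ground M].
have cardA : #|A| = #|ground M|.
  rewrite -(card_imset A (_ : injective (fun y : 'rV_(\dim (mspan M)) => y *m B))); last first.
    move=> x y /eqP; rewrite -subr_eq0 -mulmxBl => /eqP/B0/eqP.
    by rewrite subr_eq0 => /eqP.
  apply: eq_card => x; apply/imsetP/idP => [[y]|xM]; first by rewrite inE => ? ->.
  have [|y yE] := spanB x; first by rewrite memv_span // mem_enum.
  by exists y; rewrite // inE -yE.
have cardCA : #|~: A| = (2 ^ rank M - #|ground M|)%N.
  by rewrite -cardA -(card_rV_F2 (\dim (mspan M))) -(cardsC A) addKn.
have [|Phi [Phi0 PhiA]] := blowup _ A n0M; first by rewrite cardCA.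
apply: (@has_restriction_injective _ _ (row_mx 1%:M P *m Phi *m B)) => x.
  rewrite !mulmxA => /B0/Phi0.
  by rewrite mul_mx_row mulmx1 -(row_mx0 _ 1) => /eq_row_mx[].
move=> xN; have := PhiA x _ (NP x xN); rewrite inE.
by rewrite !mulmxA mul_mx_row mulmx1.
Qed.

(** * Dense matroids avoiding N *)

Lemma critical_coloring_le (M : simple_binary_matroid) k :
  (critical_number M <= k)%N ->
  exists P : 'M['F_2]_(ambient_dim M, k), forall x, x \in ground M -> x *m P != 0.
Proof.
move=> le_k; have [P P0] := critical_coloring M; rewrite -(subnKC le_k).
exists (row_mx P 0) => x xM; rewrite mul_mx_row mulmx0.
apply: contra (P0 x xM) => /eqP; rewrite -(row_mx0 _ 1) => /eq_row_mx[-> _].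
exact: eqxx.
Qed.

Lemma rank_set_free (N : simple_binary_matroid) (I : {set point_of N}) :
  free (enum I) -> rank_set N I = #|I|.
Proof. by rewrite /free cardE => /eqP. Qed.

Lemma extend_indep (N : simple_binary_matroid) (I : {set point_of N}) s :
  indep N I -> (#|I| <= s)%N -> (s <= rank N)%N ->
  exists I' : {set point_of N}, [/\ I \subset I', indep N I' & rank_set N I' = s].
Proof.
move=> indI Is sr; have [m] := ubnP (s - #|I|); elim: m I indI Is => // m IHm I indI Is sIm.
have /andP[IN Ifree] := indI.
have [Ieq|Ine] := eqVneq #|I| s; first by exists I; split; rewrite // rank_set_free.
have Ilt : (#|I| < s)%N by rewrite ltn_neqAle Ine.
have [x xN xI] : exists2 x, x \in ground N & x \notin <<enum I>>%VS.
  apply/exists_inP; rewrite -negb_forall_in; apply/negP => /forall_inP NI.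
  have : (rank N <= #|I|)%N.
    rewrite -rank_set_free //; apply: dimvS; apply/span_subvP => x.
    by rewrite mem_enum => /NI.
  by rewrite leqNgt (leq_trans Ilt sr).
have xnI : x \notin I.
  by apply: contra xI => xI; rewrite memv_span // mem_enum.
have [|||I' [I'I indI' rI']] := IHm (x |: I).
- rewrite /indep finset.subUset finset.sub1set xN IN /=.
  rewrite (perm_free (_ : perm_eq (enum (x |: I)) (x :: enum I))) ?free_cons ?xI //.
  apply: uniq_perm; rewrite ?enum_uniq //= ?mem_enum ?xnI ?enum_uniq // => y.
  by rewrite in_cons !mem_enum !inE.
- by rewrite cardsU1 xnI.
- by rewrite cardsU1 xnI; lia.
exists I'; split=> //; apply: fintype.subset_trans I'I; exact: finset.subsetUr.
Qed.

(** U is the subspace where the last [d] coordinates vanish. Its complement is a Bose-Burton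
    geometry, and [L] is copied into U. *)
Definition bose_burton_plus n d (L : {set 'rV['F_2]_n}) : {set 'rV['F_2]_(n + d)} :=
  [set x : 'rV_(n + d) | (rsubmx x != 0) || (lsubmx x \in L)].

Lemma card_bose_burton_plus n d (L : {set 'rV['F_2]_n}) :
  (2 ^ (n + d) <= #|bose_burton_plus d L| + 2 ^ n)%N.
Proof.
rewrite -(card_rV_F2 (n + d)) -(cardsC (bose_burton_plus d L)) leq_add2l.
rewrite -(card_rV_F2 n) -cardsT.
apply: leq_trans _ (leq_imset_card (fun u : 'rV['F_2]_n => row_mx u (0 : 'rV_d)) _).
apply/subset_leq_card; apply/fintype.subsetP => x; rewrite !inE negb_or negbK.
case/andP=> /eqP x0 _; apply/imsetP; exists (lsubmx x) => //.
by rewrite -{1}(hsubmxK x) x0.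
Qed.

Lemma zero_notin_bose_burton_plus g n d (L : {set 'rV['F_2]_n}) :
  (0 < g)%N -> short_circuit_free g L -> 0 \notin bose_burton_plus d L.
Proof.
move=> g0 Lfree; rewrite inE !raddf0 eqxx /=; apply/negP => L0.
have /setP/(_ 0) : [set (0 : 'rV['F_2]_n)] = finset.set0.
  by apply: Lfree; rewrite ?finset.sub1set ?cards1 ?big_set1.
by rewrite !inE eqxx.
Qed.

Lemma bose_burton_plus_free (N : simple_binary_matroid) d n
    (L : {set 'rV['F_2]_n}) (G : 'M['F_2]_(ambient_dim N, n + d)) :
  critical_number N = d.+1 ->
  (forall I : {set point_of N}, indep N I ->
     rank_set N I = (rank N - d.+1 + 1)%N -> critical_number (delete N I) = d.+1) ->
  short_circuit_free #|ground N| L ->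
  {in ground N &, injective (mulmx^~ G)} ->
  ~ (forall x, x \in ground N -> x *m G \in bose_burton_plus d L).
Proof.
move=> chiN chiND Lfree G_inj GM.
have splitG (x : point_of N) : x *m G = row_mx (x *m lsubmx G) (x *m rsubmx G).
  by rewrite -{1}(hsubmxK G) mul_mx_row.
have rank_d : (d < rank N)%N by rewrite -chiN critical_number_le_rank.
pose I := [set x in ground N | x *m rsubmx G == 0].
have IN : I \subset ground N by apply/fintype.subsetP => x; rewrite inE => /andP[].
have I0 x : x \in I -> x *m rsubmx G = 0 by rewrite inE => /andP[_ /eqP].
have Ifree : forall S : {set point_of N}, S \subset I -> \sum_(x in S) x = 0 -> S = finset.set0.
  (* On [I] the first block of [G] is injective with values in [L], so a zero-sum subset of [I]
     gives one of [L] with at most [#|ground N|] points. *)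
  move=> S SI S0; apply/eqP; rewrite -(imset_eq0 (mulmx^~ (lsubmx G))); apply/eqP.
  apply: Lfree.
  - apply/fintype.subsetP => _ /imsetP[x xS ->]; have xI := fintype.subsetP SI _ xS.
    have := GM _ (fintype.subsetP IN _ xI).
    by rewrite inE splitG row_mxKl row_mxKr I0 ?eqxx.
  - apply: leq_trans (leq_imset_card _ _) _; apply: subset_leq_card.
    exact: fintype.subset_trans IN.
  rewrite big_imset /=; last first.
    move=> x y xS yS Gxy; have xI := fintype.subsetP SI _ xS.
    have yI := fintype.subsetP SI _ yS; apply: G_inj; rewrite ?(fintype.subsetP IN) //=.
    by rewrite !splitG Gxy !I0.
  by rewrite -mulmx_suml S0 mul0mx.
have Iindep : indep N I by rewrite /indep IN; apply/free_zero_sumP.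
have [Ismall|Ibig] := leqP #|I| (rank N - d.+1 + 1).
  have [|I' [II' I'indep rI']] := extend_indep Iindep Ismall; first by lia.
  suff : (critical_number (delete N I') <= d)%N by rewrite chiND // ltnn.
  (* The last [d] coordinates vanish together at no point of [N] outside [I]. *)
  apply: (@critical_number_le_coloring (delete N I') _ (rsubmx G)) => x.
  rewrite inE => /andP[xI' xN]; apply: contra xI' => x0.
  by apply: (fintype.subsetP II'); rewrite inE xN x0.
pose D := (mspan N :&: lker (linfun (mulmxr (rsubmx G))))%VS.
have dimD : (#|I| <= \dim D)%N.
  rewrite -rank_set_free //; last by case/andP: Iindep.
  apply: dimvS; apply/span_subvP => x; rewrite mem_enum => xI.
  rewrite memv_cap mem_lker_mulmxr I0 ?eqxx // andbT memv_span // mem_enum.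
  exact: fintype.subsetP IN _ xI.
(* A functional equal to [1] on the independent set [I] cuts [D] down to a
   subspace of codimension at most [d] that misses all of [N]. *)
have [psi psi1] : exists psi : 'M['F_2]_(ambient_dim N, 1),
    forall x, x \in I -> x *m psi = const_mx 1.
  apply: (@zero_sum_linear _ _ I (fun=> const_mx 1)) => S SI S0.
  by rewrite (Ifree S SI S0) big_set0.
pose X := (D :&: lker (linfun (mulmxr psi)))%VS.
suff : (critical_number N <= d)%N by rewrite chiN ltnn.
apply: (@critical_number_le_subspace N (mspan N) X) => // [x xN|].
  apply/negP => /memv_capP[/memv_capP[_ x0] psi_x]; move: x0.
  rewrite mem_lker_mulmxr => x0; move: psi_x.
  rewrite (mem_lker_mulmxr psi x) => /eqP.
  rewrite psi1; last by rewrite inE xN.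
  by move/rowP/(_ 0); rewrite !mxE.
(* Here [#|I|] is at least [rank N - d + 1] and [psi] costs at most one dimension, so [X] has
   dimension at least [rank N - d]. *)
rewrite (capv_idPr _); last by rewrite /X /D -capvA capvSl.
have := dim_limg_le psi D; rewrite -/X.
have : \dim (mspan N) = rank N by [].
move: dimD Ibig rank_d; lia.
Qed.

Lemma dense_avoiding_matroid (N : simple_binary_matroid) d k :
  critical_number N = d.+1 ->
  (forall I : {set point_of N}, indep N I ->
     rank_set N I = (rank N - d.+1 + 1)%N -> critical_number (delete N I) = d.+1) ->
  exists M : simple_binary_matroid, [/\ ~ has_restriction M N,
    (k < critical_number M)%N
    & ((2 ^ d - 1) * 2 ^ rank M <= 2 ^ d * #|ground M|)%N].
Proof.
move=> chiN chiND.
(* The successor makes the girth bound positive, which keeps 0 out of [L]. *)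
have [n [L [Lfree Lhit]]] := sparse_high_critical_number #|ground N|.+1 k.
pose M := SimpleBinaryMatroid (zero_notin_bose_burton_plus d (ltn0Sn _) Lfree).
exists M; split.
- case=> X [XM [f [f_inj fN f_indep]]].
  have f_free (S : {set point_of N}) : S \subset ground N ->
      free (enum (f @: S)) = free (enum S).
    move=> SN; have := f_indep S SN.
    have fS : f @: S \subset ground (restrict M X) by rewrite -fN imsetS.
    by rewrite /indep SN fS.
  (* By uniqueness of binary representations the isomorphism is linear on [N]. *)
  have [G Gf] := independence_preserving_linear f_inj f_free.
  have Lfree' : short_circuit_free #|ground N| L.
    by move=> S SL Sg; exact: Lfree SL (leqW Sg).
  apply: (@bose_burton_plus_free N d n L G) => //.
    by move=> x y xN yN /=; rewrite !Gf //; apply: f_inj.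
  move=> x xN; rewrite Gf //; have : f x \in f @: ground N by apply: imset_f.
  by rewrite fN inE => /andP[].
- rewrite ltnNge; apply/negP => /critical_coloring_le[P P0].
  (* [usubmx P] is the restriction of [P] to U. *)
  have [x xL xP] := Lhit (usubmx P).
  have /P0 : row_mx x 0 \in ground M by rewrite inE row_mxKl xL orbT.
  by rewrite -(vsubmxK P) mul_row_col xP mul0mx addr0 eqxx.
have rM : (rank M <= n + d)%N.
  by apply: leq_trans (dimvS (subvf _)) _; rewrite dimvf dim_matrix mul1r.
apply: (@leq_trans ((2 ^ d - 1) * 2 ^ (n + d))).
  by rewrite leq_mul2l leq_exp2l // rM orbT.
rewrite mulnBl mul1n leq_subLR.
have := leq_mul (leqnn (2 ^ d)) (card_bose_burton_plus d L).
by rewrite mulnDr [leqRHS]addnC -(expnD 2 d n) (addnC d).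
Qed.

(** * The threshold as an infimum *)

Lemma card_ground_le (M : simple_binary_matroid) : (#|ground M| <= 2 ^ rank M)%N.
Proof.
have [B [_ spanB]] := vspace_coordinates (mspan M).
rewrite -(card_rV_F2 (\dim (mspan M))) -cardsT.
apply: leq_trans _ (leq_imset_card (fun y : 'rV_(\dim (mspan M)) => y *m B) _).
apply/subset_leq_card; apply/fintype.subsetP => x xM.
have [|y ->] := spanB x; first by rewrite memv_span // mem_enum.
exact: imset_f.
Qed.

Lemma archimedean_expn (R : realType) (eps : R) : 0 < eps ->
  exists e, 1 <= eps * 2 ^+ e.
Proof.
move=> eps0; exists (Num.bound eps^-1); rewrite mulrC -ler_pdivrMr //.
rewrite div1r; apply: le_trans (ltW (archi_boundP _)) _; first by rewrite invr_ge0 ltW.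
by rewrite -natrX ler_nat ltnW // ltn_expl.
Qed.

Theorem theorem1p6 (R : realType) (N : simple_binary_matroid) (c : nat)
    (chiN : critical_number N = c) (c_ge1 : (1 <= c)%N)
    (chiND : forall I : {set point_of N}, indep N I ->
       rank_set N I = (rank N - c + 1)%N -> critical_number (delete N I) = c) :
  critical_threshold R N = 1 - 2 ^ (1 - c%:Z).
Proof.
case: c chiN c_ge1 chiND => // d chiN _ chiND.
have -> : 2 ^ (1 - d.+1%:Z) = (2 ^+ d)^-1 :> R.
  by rewrite exprnN; congr (_ ^ _); lia.
have p0 : 0 < 2 ^+ d :> R by rewrite exprn_gt0.
have p1 : 1 <= 2 ^+ d :> R by rewrite exprn_ege1 // ler1n.
have b0 : 0 <= 1 - (2 ^+ d)^-1 :> R by rewrite subr_ge0 invf_le1.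
rewrite /critical_threshold; set S := (X in inf X).
have S_lb alpha : S alpha -> 1 - (2 ^+ d)^-1 <= alpha.
  case=> alpha0 [k Sk]; rewrite leNgt; apply/negP => alpha_lt.
  have [M [MN kM densM]] := dense_avoiding_matroid k chiN chiND.
  move: kM; rewrite ltnNge Sk //.
  apply: (@le_trans _ _ ((1 - (2 ^+ d)^-1) * 2 ^+ rank M)).
    by rewrite ler_wpM2r ?exprn_ge0 // ltW.
  rewrite -(ler_pM2l p0) mulrA mulrBr mulr1 divff ?gt_eqF //.
  by move: densM; rewrite -(ler_nat R) !natrM natrB ?expn_gt0 // !natrX.
have S_eps eps : 0 < eps -> S (1 - (2 ^+ d)^-1 + eps).
  move=> eps0; split; first exact: ltr_wpDl.
  have [e eps_e] := archimedean_expn eps0.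
  have [n0 dense] := dense_has_restriction N e.
  (* Rank bounds critical number, so a critical number above [n0] forces rank at least [n0] and
     hence a copy of [N]. *)
  exists n0 => M MN densM; rewrite leqNgt; apply/negP => /ltnW n0M; apply: MN.
  apply: dense; first exact: leq_trans n0M (critical_number_le_rank M).
  rewrite chiN -(ler_nat R) natrD !natrM.
  rewrite natrB ?card_ground_le // !natrX addSn exprS exprD addn1 exprS.
  move: densM eps_e; set r := 2 ^+ rank M; set x := #|_|%:R.
  have r0 : 0 <= r by rewrite exprn_ge0.
  set D := 2 ^+ d in p0 p1 *; set E := 2 ^+ e => dens eps_e.
  have E0 : 0 <= E by rewrite exprn_ge0.
  (* The goal reads [2 * D * E * (r - x) + r <= 2 * E * r]. [H1] is the density bound scaled by
     [D * E]; the surplus [2 * D * r * eps * E] absorbs [r] since [eps * E >= 1]. *)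
  have H1 : D * E * (r - x) <= E * (r - D * (eps * r)).
    rewrite mulrAC (mulrC _ E) ler_wpM2l // mulrBr lerBlDl.
    have := ler_wpM2l (ltW p0) dens; rewrite mulrA mulrDr mulrBr mulr1 divff ?gt_eqF //.
    lra.
  have H2 : D * r <= D * r * (eps * E) by rewrite ler_peMr ?mulr_ge0 // ltW.
  have H3 : r <= D * r by rewrite ler_peMl.
  lra.
apply/eqP; rewrite eq_le; apply/andP; split; last first.
  apply: lb_le_inf => //; by exists (1 - (2 ^+ d)^-1 + 1); apply: S_eps.
apply/ler_addgt0Pr => eps eps0; apply: ge_inf; last exact: S_eps.
by exists (1 - (2 ^+ d)^-1).
Qed.
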